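(* Each of the following is an inv-Wilf equivalence class: \begin{align*} &\big\{\{123,132,231\},\{123,132,312\},\{123,213,231\},\{123,213,312\}\big\},\\ &\big\{\{132,231,321\},\{132,312,321\},\{213,231,321\},\{213,312,321\}\big\},\\ &\big\{\{132,213,231\},\{132,213,312\}\big\},\\ &\big\{\{132,231,312\},\{213,231,312\}\big\}. \end{align*} All other inv-Wilf equivalence classes for $\Pi\subset\mathfrak S_3$ with $\#\Pi=3$ and $\{123,321\}\not\subset\Pi$ consist of a single triple.
   Context: $\mathfrak S_n$ is the set of permutations $\sigma=a_1a_2\ldots a_n$ of $[n]$ in one-line notation. A permutation $\sigma$ avoids $\pi\in\mathfrak S_k$ if no subsequence of $\sigma$ is order isomorphic to $\pi$ (has its entries in the same relative order as $\pi$). For a set $\Pi$ of permutations, $\mathrm{Av}_n(\Pi)$ is the set of $\sigma\in\mathfrak S_n$ avoiding every element of $\Pi$. The inversion number is $\mathrm{inv}\,\sigma=\#\{(i,j): i<j,\ a_i>a_j\}$, and $I_n(\Pi;q)=\sum_{\sigma\in \mathrm{Av}_n(\Pi)}q^{\mathrm{inv}\,\sigma}$. Sets $\Pi,\Pi'$ are inv-Wilf equivalent if $I_n(\Pi;q)=I_n(\Pi';q)$ for all $n\ge0$. Equivalence classes are taken among subsets of $\mathfrak S_3$. *)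

(* Defs.v *)
From mathcomp Require Import all_boot all_order all_fingroup all_algebra.

Set Implicit Arguments.
Unset Strict Implicit.
Unset Printing Implicit Defensive.

Import GRing.Theory.
Local Open Scope ring_scope.

(* [f] enumerates, in increasing order, the positions of a subsequence of
   [s] that is order isomorphic to [p]. *)
Definition contains n k (s : 'S_n) (p : 'S_k) : bool :=
  [exists f : {ffun 'I_k -> 'I_n}, forall i : 'I_k, forall j : 'I_k,
     ((i < j)%N ==> (f i < f j)%N) && ((s (f i) < s (f j))%N == (p i < p j)%N)].

Definition avoids n k (s : 'S_n) (p : 'S_k) : bool := ~~ contains s p.

Definition Av n k (P : {set 'S_k}) : {set 'S_n} :=
  [set s : 'S_n | [forall p in P, avoids s p]].

Definition inv n (s : 'S_n) : nat :=
  #|[set ij : 'I_n * 'I_n | (ij.1 < ij.2)%N && (s ij.2 < s ij.1)%N]|.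

Definition inv_poly n k (P : {set 'S_k}) : {poly int} :=
  \sum_(s in Av n P) 'X^(inv s).

Definition inv_Wilf k (P P' : {set 'S_k}) : Prop :=
  forall n, inv_poly n P = inv_poly n P'.

Definition inv_Wilf_class k (C : {set {set 'S_k}}) : Prop :=
  exists P : {set 'S_k}, forall P' : {set 'S_k}, P' \in C <-> inv_Wilf P P'.

(* One-line notation with letters 1, ..., n.+1; a list that is not a permutation
   of these letters gives the identity. *)
Definition oneline n (w : seq nat) : 'S_n.+1 :=
  insubd (1%g : 'S_n.+1) [ffun i : 'I_n.+1 => inord (nth 0%N w i).-1].

Definition s123 : 'S_3 := oneline 2 [:: 1; 2; 3]%N.
Definition s132 : 'S_3 := oneline 2 [:: 1; 3; 2]%N.
Definition s213 : 'S_3 := oneline 2 [:: 2; 1; 3]%N.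
Definition s231 : 'S_3 := oneline 2 [:: 2; 3; 1]%N.
Definition s312 : 'S_3 := oneline 2 [:: 3; 1; 2]%N.
Definition s321 : 'S_3 := oneline 2 [:: 3; 2; 1]%N.

Definition word n (s : 'S_n) : seq nat := [seq (val (s i)).+1 | i <- enum 'I_n].

Lemma word_oneline n (w : seq nat) :
  perm_eq w (iota 1 n.+1) -> word (oneline n w) = w.
Proof.
move=> pw; have szw : size w = n.+1 by rewrite (perm_size pw) size_iota.
have uw : uniq w by rewrite (perm_uniq pw) iota_uniq.
have wP (i : 'I_n.+1) : (0 < nth 0 w i < n.+2)%N.
  by have := mem_nth 0%N (_ : (i < size w)%N); rewrite szw (perm_mem pw) mem_iota;
     apply.
have fE (i : 'I_n.+1) :
    (val (inord (nth 0%N w i).-1 : 'I_n.+1)).+1 = nth 0%N w i.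
  have /andP[w0 wn] := wP i.
  by rewrite /= inordK prednK // -ltnS.
have inj_f : injectiveb [ffun i : 'I_n.+1 => inord (nth 0%N w i).-1 : 'I_n.+1].
  apply/injectiveP => i j; rewrite !ffunE => /(congr1 (fun x => (val x).+1)).
  by rewrite !fE => /eqP; rewrite nth_uniq ?szw // => /eqP/val_inj.
have oE i : (val (oneline n w i)).+1 = nth 0%N w i.
  by rewrite -[in RHS]fE /oneline -pvalE insubdK // ffunE.
rewrite /word (eq_map oE) -[RHS](mkseq_nth 0%N) szw /mkseq -val_enum_ord.
by rewrite -map_comp.
Qed.

(* Main.v *)
Require Import Defs.
From mathcomp Require Import all_boot all_order all_fingroup all_algebra.

(** Inversion of permutations and conjugation by the order-reversing permutation
    (reverse-complement) both preserve the inversion number and pattern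
    containment, so they carry a set of patterns to an inv-Wilf equivalent one
    ([symmetry_inv_Wilf]).  On S_3 the first exchanges 231 and 312 and the second
    exchanges both 132 with 213 and 231 with 312; together they realise every
    rearrangement of S_3 within the levels of constant inversion number, namely
    123 | 132, 213 | 231, 312 | 321.

    Conversely, a permutation of size k contains a pattern of size k only if it
    equals it, so the polynomial of size k of a set of patterns P in S_k is the
    generating function of the complement of P, and it determines how many
    elements of P lie in each level ([inv_Wilf_inv_count]).  In S_3 these counts
    are therefore a complete invariant: two subsets of S_3 are inv-Wilf
    equivalent exactly when they meet every level equally often
    ([inv_Wilf_S3P]).

    A triple is alone in its class if and only if it meets each of the two
    levels of size 2 in 0 or 2 elements.  Among the triples that do not contain
    both 123 and 321, those that meet one of these levels in a single element
    have counts (1,1,1,0), (0,1,1,1), (0,2,1,0) or (0,1,2,0) on the four levels,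
    and these four possibilities are the four listed classes. *)

Set Implicit Arguments.
Unset Strict Implicit.
Unset Printing Implicit Defensive.

Import GRing.Theory.

(* The name inv is also that of the inverse in fraction fields. *)
Local Notation inv := Defs.inv.

(** * Symmetries of pattern containment *)

Lemma containsP n k (s : 'S_n) (p : 'S_k) :
  reflect (exists f : 'I_k -> 'I_n,
             (forall i j : 'I_k, (f i < f j) = (i < j)) /\
             (forall i j, (s (f i) < s (f j)) = (p i < p j)))
          (contains s p).
Proof.
apply: (iffP existsP) => [[f /forallP fP]|[f [f_mono f_pat]]].
  have f_incr (i j : 'I_k) : i < j -> f i < f j.
    by move/forallP: (fP i) => /(_ j)/andP[/implyP].
  exists f; split=> i j; last by move/forallP: (fP i) => /(_ j)/andP[_ /eqP].
  case: (ltngtP i j) => [/f_incr //|/f_incr/ltnW|/val_inj->]; last exact: ltnn.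
  by rewrite leqNgt => /negbTE.
exists [ffun i => f i]; apply/forallP => i; apply/forallP => j.
by rewrite !ffunE f_mono f_pat implybb eqxx.
Qed.

(** If f lists the positions of an occurrence of p in s, the values at these
    positions, listed in increasing order, are the positions of an occurrence of
    the inverse of p in the inverse of s. *)
Lemma contains_invg n k (s : 'S_n) (p : 'S_k) :
  contains s p -> contains s^-1%g p^-1%g.
Proof.
move=> /containsP[f [f_mono f_pat]]; apply/containsP.
exists (fun i => s (f (p^-1%g i))); split=> i j.
  by rewrite f_pat !permKV.
by rewrite !permK f_mono.
Qed.

Definition revcomp n (s : 'S_n) : 'S_n := (s ^ perm (@rev_ord_inj n))%g.

Lemma revcompE n (s : 'S_n) i : revcomp s i = rev_ord (s (rev_ord i)).
Proof.
rewrite -{1}[i]rev_ordK -[rev_ord (rev_ord i)](permE rev_ord_inj).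
by rewrite permJ permE.
Qed.

Lemma revcompK n : involutive (@revcomp n).
Proof. by move=> s; apply/permP => i; rewrite !revcompE !rev_ordK. Qed.

Lemma ltn_rev_ord n (i j : 'I_n) : (rev_ord i < rev_ord j) = (j < i).
Proof. by rewrite /= ltn_sub2lE // ltnS. Qed.

Lemma contains_revcomp n k (s : 'S_n) (p : 'S_k) :
  contains s p -> contains (revcomp s) (revcomp p).
Proof.
move=> /containsP[f [f_mono f_pat]]; apply/containsP.
exists (fun i => rev_ord (f (rev_ord i))); split=> i j.
  by rewrite ltn_rev_ord f_mono ltn_rev_ord.
by rewrite !revcompE !rev_ordK !ltn_rev_ord f_pat.
Qed.

(** A pair (i, j) is an inversion of s exactly when the pair (s j, s i) is one of
    the inverse of s. *)
Lemma inv_invg n (s : 'S_n) : inv s^-1%g = inv s.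
Proof.
pose h (ij : 'I_n * 'I_n) := (s ij.2, s ij.1).
have h_inj : injective h.
  by move=> [i j] [i' j'] [/perm_inj -> /perm_inj ->].
rewrite /inv -(card_preimset _ h_inj); apply: eq_card => -[i j].
by rewrite !inE /= !permK andbC.
Qed.

Lemma inv_revcomp n (s : 'S_n) : inv (revcomp s) = inv s.
Proof.
pose h (ij : 'I_n * 'I_n) := (rev_ord ij.2, rev_ord ij.1).
have hK : involutive h by case=> i j; rewrite /h /fst /snd !rev_ordK.
rewrite /inv -(card_preimset _ (inv_inj hK)); apply: eq_card => -[i j].
by rewrite !inE /h /fst /snd !revcompE !rev_ordK !ltn_rev_ord.
Qed.

(** The bijection phi of S_n carries the permutations avoiding the preimage of P
    to those avoiding P. *)
Lemma symmetry_inv_Wilf (phi : forall n, 'S_n -> 'S_n) :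
    (forall n, involutive (phi n)) ->
    (forall n (s : 'S_n), inv (phi n s) = inv s) ->
    (forall n k (s : 'S_n) (p : 'S_k),
       contains s p -> contains (phi n s) (phi k p)) ->
  forall k (P : {set 'S_k}), inv_Wilf P (phi k @^-1: P).
Proof.
move=> phiK phi_inv phi_contains k P n.
rewrite /inv_poly [LHS](reindex_inj (inv_inj (phiK n))).
apply: eq_big => [s|s _]; last by rewrite phi_inv.
rewrite !inE; apply/forall_inP/forall_inP => avP p pP; apply/negP => sp.
  have /negP[] : avoids (phi n s) (phi k p) by apply: avP; rewrite inE in pP.
  exact: phi_contains.
have /negP[] : avoids s (phi k p) by apply: avP; rewrite inE phiK.
by rewrite -[s]phiK; apply: phi_contains.
Qed.

Lemma inv_Wilf_invg k (P : {set 'S_k}) : inv_Wilf P (invg @^-1: P).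
Proof.
apply: (symmetry_inv_Wilf (phi := fun n (s : 'S_n) => s^-1%g)) => *.
- exact: invgK.
- exact: inv_invg.
- exact: contains_invg.
Qed.

Lemma inv_Wilf_revcomp k (P : {set 'S_k}) : inv_Wilf P (@revcomp k @^-1: P).
Proof.
by apply: (symmetry_inv_Wilf revcompK) => *;
   [exact: inv_revcomp | exact: contains_revcomp].
Qed.

(** * Inversion counts of a set of patterns *)

Definition inv_count k (P : {set 'S_k}) d := #|[set p in P | inv p == d]|.

(** An increasing map satisfies i <= f i; so does its conjugate by order reversal,
    which gives f i <= i. *)
Lemma incr_ord_id k (f : 'I_k -> 'I_k) :
  (forall i j : 'I_k, (f i < f j) = (i < j)) -> f =1 id.
Proof.
have ge_id (g : 'I_k -> 'I_k) :
    (forall i j : 'I_k, (g i < g j) = (i < j)) -> forall i : 'I_k, i <= g i.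
  move=> g_mono [m ltmk]; elim: m ltmk => //= m IHm ltmk.
  by apply: leq_ltn_trans (IHm (ltnW ltmk)) _; rewrite g_mono /=.
move=> f_mono i; apply/val_inj/eqP; rewrite /= eqn_leq ge_id // andbT.
have := ge_id (fun j => rev_ord (f (rev_ord j))) _ (rev_ord i).
rewrite rev_ordK [(rev_ord i <= _)%N]leqNgt ltn_rev_ord -leqNgt.
by apply=> j l; rewrite ltn_rev_ord f_mono ltn_rev_ord.
Qed.

(** An occurrence of p in s uses all the positions, in order. *)
Lemma contains_same_size k (s p : 'S_k) : contains s p = (s == p).
Proof.
apply/idP/eqP => [/containsP[f [f_mono f_pat]]|->]; last first.
  by apply/containsP; exists id.
have fid := incr_ord_id f_mono.
have sp_mono (i j : 'I_k) : ((p^-1 * s)%g i < (p^-1 * s)%g j) = (i < j).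
  by have := f_pat (p^-1%g i) (p^-1%g j); rewrite !fid !permM !permKV.
by apply/permP => i; have := incr_ord_id sp_mono (p i); rewrite permM permK.
Qed.

(** In size k only the elements of P fail to avoid P, so the coefficients of the
    polynomial count, by inversion number, the complement of P. *)
Lemma inv_Wilf_inv_count k (P Q : {set 'S_k}) :
  inv_Wilf P Q -> inv_count P =1 inv_count Q.
Proof.
have AvE (R : {set 'S_k}) : Av k R = ~: R.
  apply/setP => s; rewrite !inE; apply/forall_inP/idP => [avs|sR p pR].
    by apply/negP => /avs; rewrite /avoids contains_same_size eqxx.
  by rewrite /avoids contains_same_size; apply: contraNneq sR => ->.
have countE (R : {set 'S_k}) d :
    ((inv_count R d)%:R = (\sum_(s : 'S_k) 'X^(inv s) - inv_poly k R)`_d :> int)%R.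
  have -> : inv_poly k R = (\sum_(s | s \notin R) 'X^(inv s))%R.
    by apply: eq_bigl => s; rewrite AvE inE.
  rewrite (bigID (mem R)) /= addrK coef_sum /inv_count -sum1dep_card natr_sum.
  rewrite big_mkcondr; apply: eq_bigr => s _.
  by rewrite coefXn eq_sym; case: eqP.
by move=> PQ d; apply/eqP; rewrite -(Num.Theory.eqr_nat int) !countE PQ.
Qed.

(** * One-line notation *)

Lemma word_nth n (s : 'S_n) (i : 'I_n) : (val (s i)).+1 = nth 0 (word s) i.
Proof. by rewrite (nth_map i) ?size_enum_ord ?nth_ord_enum. Qed.

Lemma word_inj n : injective (@word n).
Proof.
move=> s t st; apply/permP => i; apply/val_inj/succn_inj.
by rewrite !word_nth st.
Qed.

Lemma inv_word n (s : 'S_n) :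
  inv s = \sum_(i < n) \sum_(j < n) (i < j) && (nth 0 (word s) j < nth 0 (word s) i).
Proof.
rewrite /Defs.inv -sum1dep_card big_mkcond /= pair_big /=.
by apply: eq_bigr => -[i j] _ /=; rewrite -!word_nth ltnS; case: ifP.
Qed.

Lemma word_mkseq n (s : 'S_n) (F : nat -> nat) :
  (forall i, (val (s i)).+1 = F i) -> word s = mkseq F n.
Proof. by move=> sF; rewrite /word (eq_map sF) /mkseq -val_enum_ord -map_comp. Qed.

Lemma word_invg n (s : 'S_n) :
  word s^-1%g = mkseq (fun i => (index i.+1 (word s)).+1) n.
Proof.
apply: word_mkseq => i; rewrite -{2}[i](permKV s) index_map ?index_enum_ord //.
by move=> j k /succn_inj/val_inj/perm_inj.
Qed.

Lemma word_revcomp n (s : 'S_n) :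
  word (revcomp s) = mkseq (fun i => n.+1 - nth 0 (word s) (n - i.+1)) n.
Proof.
apply: word_mkseq => i; rewrite revcompE.
by rewrite (_ : n - i.+1 = rev_ord i) // -word_nth subSS /= subnSK.
Qed.

(** * The symmetric group of degree 3 *)

Definition S3 : seq 'S_3 := [:: s123; s132; s213; s231; s312; s321].

Definition S3_words : seq (seq nat) :=
  [:: [:: 1; 2; 3]; [:: 1; 3; 2]; [:: 2; 1; 3];
      [:: 2; 3; 1]; [:: 3; 1; 2]; [:: 3; 2; 1]].

Lemma map_word_S3 : map (@word 3) S3 = S3_words.
Proof. by rewrite /= !word_oneline. Qed.

Lemma uniq_S3 : uniq S3.
Proof. by apply: (@map_uniq _ _ (@word 3)); rewrite map_word_S3. Qed.

Lemma mem_S3 s : s \in S3.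
Proof.
have [|_ ->] := uniq_min_size uniq_S3 (fun x _ => mem_enum 'S_3 x).
  by rewrite -cardE card_Sn.
by rewrite mem_enum.
Qed.

Lemma eq_in_S3 (P Q : {set 'S_3}) :
  (P == Q) = all (fun s => (s \in P) == (s \in Q)) S3.
Proof.
apply/eqP/allP => [-> s _ //|PQ]; apply/setP => s.
exact/eqP/PQ/mem_S3.
Qed.

Lemma map_inv_S3 : map (@inv 3) S3 = [:: 0; 1; 1; 2; 2; 3].
Proof. by rewrite /= !inv_word !big_ord_recl !big_ord0 !word_oneline. Qed.

Lemma perm_index_enum_S3 : perm_eq (index_enum 'S_3) S3.
Proof.
rewrite uniq_perm ?index_enum_uniq ?uniq_S3 // => s.
by rewrite mem_index_enum mem_S3.
Qed.

Lemma card_S3 (P : {set 'S_3}) : #|P| = \sum_(s <- S3) (s \in P).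
Proof.
rewrite -sum1_card big_mkcond /= [LHS](perm_big _ perm_index_enum_S3).
by apply: eq_bigr => s _; case: (_ \in _).
Qed.

Lemma inv_count_level (P : {set 'S_3}) :
  [/\ inv_count P 0 = (s123 \in P), inv_count P 1 = (s132 \in P) + (s213 \in P),
      inv_count P 2 = (s231 \in P) + (s312 \in P) & inv_count P 3 = (s321 \in P)].
Proof.
have [i1 i2 i3 i4 i5 i6] := map_inv_S3.
rewrite /inv_count !card_S3 /S3 !big_cons !big_nil !inE i1 i2 i3 i4 i5 i6.
by split; rewrite ?andbT ?andbF ?addn0.
Qed.

Lemma map_invg_S3 :
  map invg S3 = [:: s123; s132; s213; s312; s231; s321].
Proof.
apply: (inj_map (@word_inj 3)).
by rewrite /= !word_invg !word_oneline.
Qed.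

Lemma map_revcomp_S3 :
  map (@revcomp 3) S3 = [:: s123; s213; s132; s312; s231; s321].
Proof.
apply: (inj_map (@word_inj 3)).
by rewrite /= !word_revcomp !word_oneline.
Qed.

Lemma inv_Wilf_trans k (P Q R : {set 'S_k}) :
  inv_Wilf P Q -> inv_Wilf Q R -> inv_Wilf P R.
Proof. by move=> PQ QR n; rewrite PQ. Qed.

Lemma addb_eq_swap (a b c d : bool) :
  a + b = c + d -> (c = a /\ d = b) \/ (c = b /\ d = a).
Proof. by case: a b c d => [] [] [] [] //; auto. Qed.

(** Equality of the inversion counts in S_3, the levels being 123 | 132, 213 |
    231, 312 | 321. *)
Definition same_levels (P Q : {set 'S_3}) :=
  [&& (s123 \in P) == (s123 \in Q),
      (s132 \in P) + (s213 \in P) == (s132 \in Q) + (s213 \in Q),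
      (s231 \in P) + (s312 \in P) == (s231 \in Q) + (s312 \in Q) &
      (s321 \in P) == (s321 \in Q)].

(** When the counts agree, P and Q differ by exchanging, or not, the two elements
    of each level of size 2.  Inversion exchanges 231 with 312 alone,
    reverse-complement makes both exchanges, and their composite exchanges 132
    with 213 alone. *)
Lemma inv_Wilf_S3P (P Q : {set 'S_3}) : inv_Wilf P Q <-> same_levels P Q.
Proof.
rewrite /same_levels.
split=> [/inv_Wilf_inv_count PQ|].
  have [P0 P1 P2 P3] := inv_count_level P.
  have [Q0 Q1 Q2 Q3] := inv_count_level Q.
  rewrite -P1 -P2 -Q1 -Q2 !PQ !eqxx /=.
  move: (PQ 0) (PQ 3); rewrite P0 Q0 P3 Q3.
  by do 4![case: (_ \in _)].
case/and4P => /eqP e0 /eqP e1 /eqP e2 /eqP e3.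
have [v1 v2 v3 v4 v5 v6] := map_invg_S3.
have [r1 r2 r3 r4 r5 r6] := map_revcomp_S3.
case: (addb_eq_swap e1) (addb_eq_swap e2) => [[q2 q3]|[q2 q3]] [[q4 q5]|[q4 q5]].
- suff -> : Q = P by [].
  by apply/eqP; rewrite eq_in_S3 /= e0 e3 q2 q3 q4 q5 !eqxx.
- suff -> : Q = invg @^-1: P by exact: inv_Wilf_invg.
  apply/eqP; rewrite eq_in_S3 /= !inE v1 v2 v3 v4 v5 v6.
  by rewrite e0 e3 q2 q3 q4 q5 !eqxx.
- suff -> : Q = invg @^-1: (@revcomp 3 @^-1: P).
    exact: inv_Wilf_trans (inv_Wilf_revcomp P) (inv_Wilf_invg _).
  apply/eqP; rewrite eq_in_S3 /= !inE v1 v2 v3 v4 v5 v6 r1 r2 r3 r4 r5 r6.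
  by rewrite e0 e3 q2 q3 q4 q5 !eqxx.
suff -> : Q = @revcomp 3 @^-1: P by exact: inv_Wilf_revcomp.
apply/eqP; rewrite eq_in_S3 /= !inE r1 r2 r3 r4 r5 r6.
by rewrite e0 e3 q2 q3 q4 q5 !eqxx.
Qed.

Lemma eq_S3_word (s t : 'S_3) : (s == t) = (word s == word t).
Proof. by rewrite (inj_eq (@word_inj 3)). Qed.

Lemma eq_S3F :
  (s123 == s132 = false) * (s123 == s213 = false) * (s123 == s231 = false) *
  (s123 == s312 = false) * (s123 == s321 = false) * (s132 == s123 = false) *
  (s132 == s213 = false) * (s132 == s231 = false) * (s132 == s312 = false) *
  (s132 == s321 = false) * (s213 == s123 = false) * (s213 == s132 = false) *
  (s213 == s231 = false) * (s213 == s312 = false) * (s213 == s321 = false) *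
  (s231 == s123 = false) * (s231 == s132 = false) * (s231 == s213 = false) *
  (s231 == s312 = false) * (s231 == s321 = false) * (s312 == s123 = false) *
  (s312 == s132 = false) * (s312 == s213 = false) * (s312 == s231 = false) *
  (s312 == s321 = false) * (s321 == s123 = false) * (s321 == s132 = false) *
  (s321 == s213 = false) * (s321 == s231 = false) * (s321 == s312 = false).
Proof. by rewrite !eq_S3_word !word_oneline. Qed.

(** * Inv-Wilf classes *)

Lemma inv_Wilf_class_eq k (C D : {set {set 'S_k}}) P :
  inv_Wilf_class C -> inv_Wilf_class D -> P \in C -> P \in D -> C = D.
Proof.
move=> [PC CP] [PD DP] /CP PCP /DP PDP; apply/setP => Q.
apply/idP/idP => [/CP QC|/DP QD]; [apply/DP|apply/CP] => n.
  by rewrite PDP -PCP QC.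
by rewrite PCP -PDP QD.
Qed.

Lemma inv_Wilf_class_S3 (C : {set {set 'S_3}}) P :
  (forall Q, (Q \in C) = same_levels P Q) -> inv_Wilf_class C.
Proof.
by move=> CE; exists P => Q; rewrite CE; apply: iff_sym (inv_Wilf_S3P P Q).
Qed.

Theorem theorem6p1 :
  let C1 := [set [set s123; s132; s231]; [set s123; s132; s312];
                 [set s123; s213; s231]; [set s123; s213; s312]] in
  let C2 := [set [set s132; s231; s321]; [set s132; s312; s321];
                 [set s213; s231; s321]; [set s213; s312; s321]] in
  let C3 := [set [set s132; s213; s231]; [set s132; s213; s312]] in
  let C4 := [set [set s132; s231; s312]; [set s213; s231; s312]] in
  [/\ inv_Wilf_class C1, inv_Wilf_class C2, inv_Wilf_class C3 & inv_Wilf_class C4]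
  /\ (forall C : {set {set 'S_3}},
        inv_Wilf_class C ->
        (exists P : {set 'S_3},
           [/\ P \in C, #|P| = 3 & ~~ ([set s123; s321] \subset P)]) ->
        C \notin [:: C1; C2; C3; C4] ->
        exists P : {set 'S_3}, #|P| = 3 /\ C = [set P]).
Proof.
move=> C1 C2 C3 C4.
have C1E Q : (Q \in C1) = same_levels [set s123; s132; s231] Q.
  rewrite !inE !eq_in_S3 /same_levels /= !inE !eqxx !eq_S3F /=.
  by do 6![case: (_ \in Q)].
have C2E Q : (Q \in C2) = same_levels [set s132; s231; s321] Q.
  rewrite !inE !eq_in_S3 /same_levels /= !inE !eqxx !eq_S3F /=.
  by do 6![case: (_ \in Q)].
have C3E Q : (Q \in C3) = same_levels [set s132; s213; s231] Q.
  rewrite !inE !eq_in_S3 /same_levels /= !inE !eqxx !eq_S3F /=.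
  by do 6![case: (_ \in Q)].
have C4E Q : (Q \in C4) = same_levels [set s132; s231; s312] Q.
  rewrite !inE !eq_in_S3 /same_levels /= !inE !eqxx !eq_S3F /=.
  by do 6![case: (_ \in Q)].
have C1_class := inv_Wilf_class_S3 C1E; have C2_class := inv_Wilf_class_S3 C2E.
have C3_class := inv_Wilf_class_S3 C3E; have C4_class := inv_Wilf_class_S3 C4E.
split=> // C C_class [P [PC cardP notP]] C_new; exists P; split=> //.
have P_new D : inv_Wilf_class D -> C != D -> P \notin D.
  move=> D_class; apply: contraNN => PD; apply/eqP.
  exact: inv_Wilf_class_eq C_class D_class PC PD.
move: C_new; rewrite !in_cons in_nil orbF !negb_or.
case/and4P => /(P_new _ C1_class) + /(P_new _ C2_class) +
              /(P_new _ C3_class) + /(P_new _ C4_class).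
rewrite {}C1E {}C2E {}C3E {}C4E.
clear C1 C2 C3 C4 C1_class C2_class C3_class C4_class P_new.
rewrite /same_levels !inE !eqxx !eq_S3F /= => nC1 nC2 nC3 nC4.
have PQ_levels Q : Q \in C -> same_levels P Q.
  case: C_class PC => P0 CP /CP P0P /CP P0Q.
  by apply/inv_Wilf_S3P => n; rewrite -P0P P0Q.
apply/setP => Q; rewrite in_set1; apply/idP/eqP => [/PQ_levels PQ|-> //].
apply/eqP; rewrite eq_in_S3; move: cardP notP nC1 nC2 nC3 nC4 PQ.
rewrite card_S3 /S3 !big_cons big_nil subUset !sub1set /same_levels /=.
by do 6![case: (_ \in P)] => //=; do 6![case: (_ \in Q)].
Qed.
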